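(* Let $\mathbb{F}$ be a division ring, $n$ a positive integer, $\sigma:\mathbb{F}\to\mathbb{F}^{n\times n}$ a ring morphism and $\delta:\mathbb{F}\to\mathbb{F}^n$ a $\sigma$-derivation. If $\mathcal{B}_1,\mathcal{B}_2\subseteq\mathbb{F}^n$ are finite non-empty P-independent sets such that no element in $\mathcal{B}_1$ is conjugate to an element in $\mathcal{B}_2$, then $\mathcal{B}=\mathcal{B}_1\cup\mathcal{B}_2$ is P-independent.
   Context: Rings are associative with identity, not necessarily commutative, and ring morphisms preserve identities. $\mathbb{F}^*=\mathbb{F}\setminus\{0\}$ and $\mathbb{F}^n$ denotes column vectors. A map $\delta:\mathbb{F}\to\mathbb{F}^n$ is a $\sigma$-derivation if $\delta(a+b)=\delta(a)+\delta(b)$ and $\delta(ab)=\sigma(a)\delta(b)+\delta(a)b$ for all $a,b\in\mathbb{F}$. Free skew polynomial ring: let $\mathcal{M}$ be the free monoid on pairwise distinct variables $x_1,\dots,x_n$. $\mathbb{F}[\mathbf{x};\sigma,\delta]$ is the left $\mathbb{F}$-vector space with basis $\mathcal{M}$, with the ring product given by concatenating monomials and $x_i a=\sum_{j=1}^n\sigma_{i,j}(a)x_j+\delta_i(a)$ for $a\in\mathbb{F}$. Skew evaluation: for $\mathbf{a}=(a_1,\dots,a_n)\in\mathbb{F}^n$, $F(\mathbf{a})$ is the unique element of $\mathbb{F}$ such that $F-F(\mathbf{a})$ belongs to the left ideal generated by $x_1-a_1,\dots,x_n-a_n$. Conjugacy: $\mathbf{a},\mathbf{b}\in\mathbb{F}^n$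 are conjugate if $\mathbf{b}=(\sigma(\beta)\mathbf{a}+\delta(\beta))\beta^{-1}$ for some $\beta\in\mathbb{F}^*$; this is an equivalence relation on $\mathbb{F}^n$. P-independence: for $\Omega\subseteq\mathbb{F}^n$, $I(\Omega)=\{F\mid F(\mathbf{a})=0\ \forall\mathbf{a}\in\Omega\}$; for a set $\mathcal{A}$ of skew polynomials, $Z(\mathcal{A})=\{\mathbf{a}\in\mathbb{F}^n\mid F(\mathbf{a})=0\ \forall F\in\mathcal{A}\}$; the P-closure is $\overline{\Omega}=Z(I(\Omega))$. A set $\Omega$ is P-independent if $\mathbf{a}\notin\overline{\Omega\setminus\{\mathbf{a}\}}$ for all $\mathbf{a}\in\Omega$. *)

(* Defs.v *)
From HB Require Import structures.
From mathcomp Require Import all_boot all_algebra.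
From mathcomp Require Import finmap.
From mathcomp Require Export monalg.
From mathcomp Require Import boolp classical_sets functions cardinality.

Set Implicit Arguments.
Unset Strict Implicit.
Unset Printing Implicit Defensive.

Import GRing.Theory.

Local Open Scope ring_scope.

(* fieldType is not usable here because it is commutative. *)
Definition division_ring (F : unitRingType) : Prop :=
  forall x : F, x != 0 -> x \is a GRing.unit.

(* A ring morphism F -> F^{n x n} is {rmorphism F -> 'M[F]_n}.  For a column
   vector v and a scalar b, the 1 x 1 matrix product v *m b%:M is the right
   multiple v b, whereas b *: v is the left multiple b v. *)
Record sderivation (F : unitRingType) (n : nat)
    (sigma : {rmorphism F -> 'M[F]_n}) := SDerivation {
  sderiv :> F -> 'cV[F]_n;
  sderivD : forall a b : F, sderiv (a + b) = sderiv a + sderiv b;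
  sderivM : forall a b : F,
    sderiv (a * b) = sigma a *m sderiv b + sderiv a *m b%:M
}.

(* The left F-vector space with basis the free monoid seq 'I_n; the word
   [:: i1; ...; ik] stands for the monomial x_i1 ... x_ik.  The parameter delta
   is a phantom one that determines the ring structure defined below. *)
Definition skewpoly (F : unitRingType) (n : nat)
    (sigma : {rmorphism F -> 'M[F]_n}) (delta : sderivation sigma) : Type :=
  {malg F[seq 'I_n]}.

HB.instance Definition _ (F : unitRingType) (n : nat)
    (sigma : {rmorphism F -> 'M[F]_n}) (delta : sderivation sigma) :=
  GRing.Lmodule.on (skewpoly delta).

Section AdditiveExtension.
Variables (K : choiceType) (G V : zmodType) (f : K -> G -> V).
Hypothesis fD : forall k, {morph f k : x y / x + y}.

Let f0 k : f k 0 = 0.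
Proof. by apply: (addrI (f k 0)); rewrite -fD !addr0. Qed.

Lemma msum_w (d : {fset K}) (g : {malg G[K]}) : (msupp g `<=` d)%fset ->
  \sum_(k <- msupp g) f k g@_k = \sum_(k <- d) f k g@_k.
Proof.
move=> le; apply: big_fset_incl => // k _ /mcoeff_outdom ->; exact: f0.
Qed.

Lemma msum0 : \sum_(k <- msupp (0 : {malg G[K]})) f k (0 : {malg G[K]})@_k = 0.
Proof. by rewrite msupp0 big_seq_fset0. Qed.

Lemma msumD (g h : {malg G[K]}) :
  \sum_(k <- msupp (g + h)) f k (g + h)@_k =
  \sum_(k <- msupp g) f k g@_k + \sum_(k <- msupp h) f k h@_k.
Proof.
rewrite (msum_w (msuppD_le g h)) (msum_w (fsubsetUl _ (msupp h))).
rewrite (msum_w (fsubsetUr (msupp g) _)) -big_split /=.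
by apply: eq_bigr => k _; rewrite mcoeffD fD.
Qed.

Lemma msumU k c :
  \sum_(l <- msupp << c *g k >>) f l << c *g k >>@_l = f k c.
Proof. by rewrite (msum_w msuppU_le) big_seq_fset1 mcoeffUU. Qed.

End AdditiveExtension.

Section SkewRing.
Variables (F : unitRingType) (n : nat).
Variables (sigma : {rmorphism F -> 'M[F]_n}) (delta : sderivation sigma).

Local Notation R := (skewpoly delta).
Local Notation mon m := (<< (1 : F) *g m >> : R).

Lemma sderiv0 : delta 0 = 0.
Proof. by apply: (addrI (delta 0)); rewrite -sderivD !addr0. Qed.

Lemma sderiv1 : delta 1 = 0.
Proof.
by apply: (addrI (delta 1)); rewrite -[in RHS](mulr1 1) sderivM rmorph1 mul1mx
  mulmx1 addr0.
Qed.

Lemma sderivMi a b i : delta (a * b) i 0 =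
  \sum_(k < n) sigma a i k * delta b k 0 + delta a i 0 * b.
Proof.
rewrite sderivM !mxE; congr (_ + _).
by rewrite big_ord1 !mxE eqxx mulr1n.
Qed.

(* Left multiplication by x_i:
   x_i (a m) = sum_j sigma_ij(a) (x_j m) + delta_i(a) m. *)
Definition skew_mulx (i : 'I_n) (G : R) : R :=
  \sum_(m <- msupp G)
    (\sum_(j < n) << sigma G@_m i j *g j :: m >> + << delta G@_m i 0 *g m >>).

(* The action of a skew polynomial on a left F-module V in which x_i acts by
   X i; it is applied below to V = skewpoly delta (multiplication) and to
   V = F (evaluation). *)
Definition skew_act (V : lmodType F) (X : 'I_n -> V -> V) (G : R) (v : V) : V :=
  \sum_(m <- msupp G) G@_m *: foldr X v m.

Definition skew_mul (G H : R) : R := skew_act skew_mulx G H.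

Definition skew_one : R := mon [::].

Section Action.
Variables (V : lmodType F) (X : 'I_n -> V -> V).
Hypothesis XD : forall i, {morph X i : u v / u + v}.
Hypothesis XZ : forall i a v,
  X i (a *: v) = \sum_(j < n) sigma a i j *: X j v + delta a i 0 *: v.

Let X0 i : X i 0 = 0.
Proof. by apply: (addrI (X i 0)); rewrite -XD !addr0. Qed.

Lemma skew_actDl v : {morph (fun G => skew_act X G v) : G H / G + H}.
Proof.
move=> G H; rewrite /skew_act.
by apply: (msumD (f := fun m c => c *: foldr X v m)) => k x y; rewrite scalerDl.
Qed.

Lemma skew_act0l v : skew_act X 0 v = 0.
Proof. exact: (msum0 (fun m c => c *: foldr X v m)). Qed.

Lemma skew_actU v c m : skew_act X << c *g m >> v = c *: foldr X v m.
Proof.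
by apply: (msumU (f := fun m c => c *: foldr X v m)) => k x y; rewrite scalerDl.
Qed.

Lemma skew_act_sum v (I : Type) (r : seq I) (P : pred I) (E : I -> R) :
  skew_act X (\sum_(i <- r | P i) E i) v =
  \sum_(i <- r | P i) skew_act X (E i) v.
Proof. exact: (big_morph _ (skew_actDl v) (skew_act0l v)). Qed.

Lemma skew_actZ v a G : skew_act X (a *: G) v = a *: skew_act X G v.
Proof.
rewrite (_ : a *: G = \sum_(m <- msupp G) << a * G@_m *g m >>) //.
rewrite skew_act_sum scaler_sumr; apply: eq_bigr => m _.
by rewrite skew_actU scalerA.
Qed.

Lemma skew_actDr G : {morph skew_act X G : u v / u + v}.
Proof.
move=> u v; rewrite /skew_act -big_split; apply: eq_bigr => m _ /=.
rewrite -scalerDr; congr (_ *: _).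
by elim: m => //= i m ->; rewrite XD.
Qed.

Lemma skew_act_mulx i G v :
  skew_act X (skew_mulx i G) v = X i (skew_act X G v).
Proof.
rewrite /skew_mulx skew_act_sum /skew_act (big_morph _ (XD i) (X0 i)).
apply: eq_bigr => m _; rewrite XZ -!/(skew_act _ _ _) skew_actDl skew_act_sum.
by rewrite skew_actU; congr (_ + _); apply: eq_bigr => j _; rewrite skew_actU.
Qed.

Lemma skew_act_mul G H v :
  skew_act X (skew_mul G H) v = skew_act X G (skew_act X H v).
Proof.
rewrite {1}/skew_mul {2}/skew_act skew_act_sum /skew_act.
apply: eq_bigr => m _; rewrite -!/(skew_act _ _ _) skew_actZ.
by congr (_ *: _); elim: m => //= i m IH; rewrite skew_act_mulx IH.
Qed.

End Action.

Let mulxf i (m : seq 'I_n) (c : F) : R :=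
  \sum_(j < n) << sigma c i j *g j :: m >> + << delta c i 0 *g m >>.

Let mulxfD i m : {morph mulxf i m : x y / x + y}.
Proof.
move=> x y; rewrite /mulxf sderivD mxE monalgUD rmorphD addrACA -big_split.
by congr (_ + _); apply: eq_bigr => j _; rewrite mxE monalgUD.
Qed.

Lemma skew_mulxD i : {morph skew_mulx i : G H / G + H}.
Proof. by move=> G H; apply: (msumD (mulxfD i)). Qed.

Lemma skew_mulxU i c m : skew_mulx i << c *g m >> =
  \sum_(j < n) << sigma c i j *g j :: m >> + << delta c i 0 *g m >>.
Proof. exact: (msumU (mulxfD i)). Qed.

Lemma skew_mulx0 i : skew_mulx i 0 = 0.
Proof. exact: (msum0 (mulxf i)). Qed.

Lemma skew_scaleU (a c : F) (m : seq 'I_n) :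
  a *: (<< c *g m >> : R) = << a * c *g m >>.
Proof.
by apply/malgP => k; rewrite mcoeffZ !mcoeffU mulrnAr.
Qed.

Lemma skew_mulxZ i a G : skew_mulx i (a *: G) =
  \sum_(j < n) sigma a i j *: skew_mulx j G + delta a i 0 *: G.
Proof.
rewrite {1}(_ : a *: G = \sum_(m <- msupp G) << a * G@_m *g m >>) //.
rewrite (big_morph _ (skew_mulxD i) (skew_mulx0 i)).
rewrite (_ : \sum_j _ = \sum_(m <- msupp G) \sum_(j < n)
    sigma a i j *: mulxf j m G@_m); last first.
  by rewrite exchange_big; apply: eq_bigr => j _; rewrite scaler_sumr.
rewrite (_ : delta a i 0 *: G =
    \sum_(m <- msupp G) << delta a i 0 * G@_m *g m >>) //.
rewrite -big_split; apply: eq_bigr => m _ /=; set c := G@_m.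
rewrite skew_mulxU sderivMi monalgUD addrA; congr (_ + _).
rewrite /mulxf [RHS](eq_bigr (fun j => \sum_(l < n) sigma a i j *:
    (<< sigma c j l *g l :: m >> : R)
    + sigma a i j *: (<< delta c j 0 *g m >> : R))); last first.
  by move=> j _; rewrite scalerDr scaler_sumr.
rewrite [RHS]big_split /=; congr (_ + _).
  rewrite exchange_big; apply: eq_bigr => j _ /=.
  rewrite rmorphM mxE raddf_sum; apply: eq_bigr => l _.
  by rewrite skew_scaleU.
by rewrite raddf_sum; apply: eq_bigr => l _; rewrite skew_scaleU.
Qed.

Lemma skew_mulx_mon i m : skew_mulx i (mon m) = mon (i :: m).
Proof.
rewrite skew_mulxU sderiv1 mxE monalgU0 addr0 rmorph1.
rewrite (bigD1 i) //= mxE eqxx big1 ?addr0 // => j /negPf ji.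
by rewrite mxE eq_sym ji monalgU0.
Qed.

Lemma skew_mulA : associative skew_mul.
Proof.
by move=> G H K; rewrite {3}/skew_mul (skew_act_mul skew_mulxD skew_mulxZ).
Qed.

Lemma skew_mul1l : left_id skew_one skew_mul.
Proof. by move=> G; rewrite /skew_mul skew_actU scale1r. Qed.

Lemma skew_mul1r : right_id skew_one skew_mul.
Proof.
move=> G; rewrite /skew_mul /skew_act [RHS]monalgE; apply: eq_bigr => m _.
rewrite (_ : foldr _ _ _ = mon m) ?skew_scaleU ?mulr1 //.
by elim: m => //= i m ->; rewrite skew_mulx_mon.
Qed.

Lemma skew_mulDl : left_distributive skew_mul +%R.
Proof. by move=> G H K; apply: skew_actDl. Qed.

Lemma skew_mulDr : right_distributive skew_mul +%R.
Proof. by move=> K G H; apply: (skew_actDr skew_mulxD). Qed.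

Lemma skew_one_neq0 : skew_one != 0.
Proof. by rewrite monalgU_eq0 oner_eq0. Qed.

HB.instance Definition _ := GRing.Zmodule_isNzRing.Build (skewpoly delta)
  skew_mulA skew_mul1l skew_mul1r skew_mulDl skew_mulDr skew_one_neq0.

Lemma skew_scalerAl (a : F) (G H : R) : a *: (G * H) = (a *: G) * H.
Proof. by rewrite -[(a *: G) * H]/(skew_act _ _ _) skew_actZ. Qed.

HB.instance Definition _ := GRing.Lmodule_isLalgebra.Build F (skewpoly delta)
  skew_scalerAl.

Definition skewX (i : 'I_n) : R := mon [:: i].

Lemma skewX_mul i G : skewX i * G = skew_mulx i G.
Proof. by rewrite -[LHS]/(skew_act _ _ _) skew_actU scale1r. Qed.

(* skewX_commute and skew_mon_cat, together with left F-linearity, determine the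
   product; they are the defining rules of F[x; sigma, delta]. *)
Lemma skewX_commute (i : 'I_n) (a : F) :
  skewX i * a%:A = \sum_(j < n) sigma a i j *: skewX j + (delta a i 0)%:A.
Proof.
rewrite skewX_mul skew_mulxZ; congr (_ + _); apply: eq_bigr => j _.
by rewrite -skewX_mul mulr1.
Qed.

Lemma skew_mon_cat (m1 m2 : seq 'I_n) : mon m1 * mon m2 = mon (m1 ++ m2).
Proof.
rewrite -[LHS]/(skew_act _ _ _) skew_actU scale1r.
by elim: m1 => //= i m1 ->; rewrite skew_mulx_mon.
Qed.

Lemma skewpolyE (G : R) :
  G = \sum_(m <- msupp G) (G@_m)%:A * \prod_(i <- m) skewX i.
Proof.
rewrite [LHS]monalgE; apply: eq_bigr => m _.
rewrite -skew_scalerAl mul1r (_ : \prod_(i <- m) _ = mon m).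
  by rewrite skew_scaleU mulr1.
by elim: m => [|i m IH]; rewrite ?big_nil // big_cons IH skew_mon_cat.
Qed.

End SkewRing.

Definition left_ideal_generated (R : nzRingType) (I : finType) (g : I -> R) : set R :=
  [set f | exists h : I -> R, f = \sum_i h i * g i].

Section SkewEvaluation.
Variables (F : unitRingType) (n : nat).
Variables (sigma : {rmorphism F -> 'M[F]_n}) (delta : sderivation sigma).
Implicit Types (G : skewpoly delta) (a b : 'cV[F]_n) (c : F).
Local Open Scope classical_set_scope.

Definition point_ideal (a : 'cV[F]_n) : set (skewpoly delta) :=
  left_ideal_generated (fun i : 'I_n => skewX delta i - (a i 0)%:A).

(* xget selects an element of its set argument, here the unique one (see
   skew_evalP and skew_eval_uniq), with default value 0. *)
Definition skew_eval G a : F := xget 0 [set c | point_ideal a (G - c%:A)].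

Let evX a (i : 'I_n) (c : F^o) : F^o := (sigma c *m a + delta c) i 0.

Let evXD a i : {morph evX a i : u v / u + v}.
Proof.
move=> u v; rewrite /evX rmorphD sderivD mulmxDl addrACA.
by rewrite [LHS]mxE.
Qed.

Let evXE a i c : evX a i c = \sum_(j < n) sigma c i j * a j 0 + delta c i 0.
Proof. by rewrite /evX !mxE. Qed.

Let evXZ a i c (v : F^o) :
  evX a i (c *: v) = \sum_(j < n) sigma c i j *: evX a j v + delta c i 0 *: v.
Proof.
rewrite /evX rmorphM -mulmxA mxE (sderivMi delta) addrA.
congr (_ + _); rewrite [X in X + _]mxE -big_split.
by apply: eq_bigr => j _; rewrite /= [in RHS]mxE -[RHS]/(sigma c i j * (_ + _)) mulrDr.
Qed.

Let ev a G : F := skew_act (V := F^o) (evX a) G 1.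

Let evD a : {morph ev a : G H / G + H}.
Proof. exact: (skew_actDl (V := F^o)). Qed.

Let ev0 a : ev a 0 = 0. Proof. exact: (@skew_act0l _ _ _ delta F^o). Qed.

Let evN a G : ev a (- G) = - ev a G.
Proof. by apply: (addrI (ev a G)); rewrite -evD !subrr ev0. Qed.

Let evC a c : ev a (c%:A) = c.
Proof. by rewrite /ev skew_actZ skew_actU scale1r -[LHS]/(c * 1) mulr1. Qed.

Let act0 a G : skew_act (V := F^o) (evX a) G 0 = 0.
Proof.
rewrite /skew_act big1 // => m _; rewrite (_ : foldr _ _ _ = 0) ?scaler0 //.
elim: m => //= i m ->; apply: (addrI (evX a i 0)).
by rewrite -evXD !addr0.
Qed.

Let ev_ideal a G : point_ideal a G -> ev a G = 0.
Proof.
move=> [h ->]; rewrite (big_morph _ (evD a) (ev0 a)) big1 // => i _.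
rewrite /ev -[h i * _]/(skew_mul _ _).
rewrite (skew_act_mul (@evXD a) (@evXZ a)) -/(ev _ _) evD evN evC.
rewrite /ev skew_actU scale1r /= /evX rmorph1 mul1mx sderiv1 addr0 subrr.
exact: act0.
Qed.

Let idealD a G H : point_ideal a G -> point_ideal a H -> point_ideal a (G + H).
Proof.
move=> [g ->] [h ->]; exists (fun i => g i + h i); rewrite -big_split.
by apply: eq_bigr => i _; rewrite mulrDl.
Qed.

Let idealM a K G : point_ideal a G -> point_ideal a (K * G).
Proof.
move=> [g ->]; exists (fun i => K * g i); rewrite mulr_sumr.
by apply: eq_bigr => i _; rewrite mulrA.
Qed.

Let ideal0 a : point_ideal a 0.
Proof. by exists (fun=> 0); rewrite big1 // => i _; rewrite mul0r. Qed.

Let ideal_sum a (I : Type) (r : seq I) (E : I -> skewpoly delta) :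
  (forall i, point_ideal a (E i)) -> point_ideal a (\sum_(i <- r) E i).
Proof.
by move=> h; elim/big_ind: _ => //; exact: idealD.
Qed.

Let evm a (m : seq 'I_n) : F := foldr (evX a) 1 m.

Let ev_mon a (m : seq 'I_n) :
  point_ideal a (\prod_(i <- m) skewX delta i - (evm a m)%:A).
Proof.
elim: m => [|i m IH].
  by rewrite big_nil /evm /= scale1r subrr; exact: ideal0.
rewrite big_cons (_ : evm a (i :: m) = evX a i (evm a m)) //.
move: (evm a m) IH => c IH.
rewrite -[X in _ * X](subrK c%:A) mulrDr -addrA.
apply: idealD; first exact: idealM.
rewrite skewX_commute evXE scalerDl opprD addrACA subrr addr0 scaler_suml -sumrB.
apply: ideal_sum => j.
rewrite -scalerA -scalerBr -[X in _ *: X]mul1r skew_scalerAl.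
apply: idealM; exists (fun k => (k == j)%:R).
rewrite (bigD1 j) //= eqxx mul1r big1 ?addr0 // => k /negPf ->.
by rewrite mul0r.
Qed.

Let ev_spec a G : point_ideal a (G - (ev a G)%:A).
Proof.
rewrite [X in X - _]skewpolyE /ev /skew_act scaler_suml -sumrB.
apply: ideal_sum => m.
rewrite -skew_scalerAl mul1r -[(_ *: foldr _ _ _)]/(_ * _) -scalerA -scalerBr.
rewrite -[X in _ *: X]mul1r skew_scalerAl.
exact/idealM/ev_mon.
Qed.

Lemma skew_evalP G a : point_ideal a (G - (skew_eval G a)%:A).
Proof. by rewrite /skew_eval; case: xgetP => [c -> //|/(_ _ (ev_spec a G))]. Qed.

Lemma skew_eval_uniq G a c : point_ideal a (G - c%:A) -> c = skew_eval G a.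
Proof.
move=> /ev_ideal; rewrite evD evN evC => /subr0_eq <-.
by have /ev_ideal := skew_evalP G a; rewrite evD evN evC => /subr0_eq.
Qed.

Definition conjugate a b : Prop :=
  exists2 beta : F, beta != 0 &
    b = (sigma beta *m a + delta beta) *m (beta^-1)%:M.

Definition vanishing (Omega : set 'cV[F]_n) : set (skewpoly delta) :=
  [set G | forall a, Omega a -> skew_eval G a = 0].

Definition zeros (A : set (skewpoly delta)) : set 'cV[F]_n :=
  [set a | forall G, A G -> skew_eval G a = 0].

Definition pclosure (Omega : set 'cV[F]_n) : set 'cV[F]_n :=
  zeros (vanishing Omega).

Definition pindependent (Omega : set 'cV[F]_n) : Prop :=
  forall a, Omega a -> ~ pclosure (Omega `\ a) a.

End SkewEvaluation.

Arguments conjugate {F n sigma} delta a b.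
Arguments vanishing {F n sigma} delta Omega.
Arguments pclosure {F n sigma} delta Omega.
Arguments pindependent {F n sigma} delta Omega.

(* Main.v *)
(* If G is a skew polynomial with G(b) = 1, then (x_i - b_i) G vanishes at b and
   at every zero of G, while all the (x_i - b_i) G vanish at a point a with
   G(a) <> 0 only if b is the conjugate of a by G(a).  Hence adjoining to a set
   finitely many points not conjugate to a never brings a into its
   P-closure. *)
Require Import Defs.
From HB Require Import structures.
From mathcomp Require Import all_boot all_algebra.
From mathcomp Require Import boolp classical_sets functions cardinality.

Set Implicit Arguments.
Unset Strict Implicit.
Unset Printing Implicit Defensive.

Import GRing.Theory.
Local Open Scope classical_set_scope.
Local Open Scope ring_scope.

Section SkewEvaluationTheory.
Variables (F : unitRingType) (n : nat).
Variables (sigma : {rmorphism F -> 'M[F]_n}) (delta : sderivation sigma).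
Implicit Types (G : skewpoly delta) (a b : 'cV[F]_n) (c : F).

Lemma skew_evalZ c G a : skew_eval (c *: G) a = c * skew_eval G a.
Proof.
apply/esym/skew_eval_uniq; have [h Gh] := skew_evalP G a.
exists (fun i => c *: h i).
rewrite -scalerA -scalerBr Gh scaler_sumr.
by apply: eq_bigr => i _; rewrite skew_scalerAl.
Qed.

(** Modulo the left ideal at [a], G is congruent to the constant g = G(a), and left multiplication
    preserves the congruence; so only (x_i - c) g has to be evaluated, by the commutation rule. *)
Lemma skew_eval_mulXB i c G a :
  skew_eval ((skewX delta i - c%:A) * G) a =
  (sigma (skew_eval G a) *m a + delta (skew_eval G a)) i 0 - c * skew_eval G a.
Proof.
have key (V : zmodType) (x y z w : V) :
    - (x + y - z) = - (w + y - z) + (w - x).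
  by rewrite -!(addrA _ y) !opprD addrACA addNr add0r addrC.
apply/esym/skew_eval_uniq; have [h] := skew_evalP G a.
move: (skew_eval G a) => g Gh.
(* The first summand accounts for (x_i - c)(G - g); the second replaces each x_j arising from x_i g
   by [a j 0]. *)
exists (fun j => (skewX delta i - c%:A) * h j + (sigma g i j)%:A).
under eq_bigr do rewrite mulrDl -mulrA.
rewrite big_split -mulr_sumr -Gh mulrBr -[RHS]addrA /=.
congr (_ + _).
rewrite mulrBl skewX_commute -skew_scalerAl mul1r scalerA.
under [X in _ = _ + X]eq_bigr do
  rewrite -skew_scalerAl mul1r scalerBr scalerA.
rewrite sumrB !mxE scalerBl scalerDl scaler_suml.
exact: key.
Qed.

Lemma pclosureS (A B : set 'cV[F]_n) :
  A `<=` B -> pclosure delta A `<=` pclosure delta B.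
Proof. by move=> AB a cl G G0; apply: cl => b /AB; exact: G0. Qed.

Hypothesis hF : division_ring F.

(** The scalar [c^-1] undoes conjugation by [c]: from 0 = delta(c^-1 c) one gets delta(c^-1) = -
    sigma(c^-1) delta(c) c^-1. *)
Lemma conjugate_sym a b : conjugate delta a b -> conjugate delta b a.
Proof.
move=> [c c0 ->]; have cU := hF c0.
exists c^-1; first by rewrite invr_eq0.
have dV : delta c^-1 = - (sigma c^-1 *m delta c *m (c^-1)%:M).
  have := sderivM delta c^-1 c; rewrite mulVr // sderiv1.
  move=> /esym/eqP; rewrite addrC addr_eq0 => /eqP.
  move=> /(congr1 (mulmx^~ (c^-1)%:M)).
  by rewrite -mulmxA -scalar_mxM divrr // mulmx1 mulNmx.
have sV : sigma c^-1 *m sigma c = 1%:M.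
  by rewrite -[LHS]/(sigma c^-1 * sigma c) -rmorphM mulVr // rmorph1.
rewrite dV invrK mulmxA -mulmxBl -mulmxBr addrK mulmxA sV mul1mx.
by rewrite -mulmxA -scalar_mxM mulVr // mulmx1.
Qed.

Lemma pclosureU1 (Omega : set 'cV[F]_n) a b : ~ conjugate delta a b ->
  pclosure delta (b |` Omega) a -> pclosure delta Omega a.
Proof.
move=> nconj cl G G0; apply: contrapT => /eqP Ga0.
have [Gb0|Gb0] := eqVneq (skew_eval G b) 0.
  by move/eqP: Ga0; apply; apply: cl => c [->|/G0].
(* Normalising to H(b) = 1 gives (x_i - b_i) H the value b_i - b_i = 0 at [b], as sigma(1) = I and
   delta(1) = 0. *)
pose H : skewpoly delta := (skew_eval G b)^-1 *: G.
have Hb : skew_eval H b = 1 by rewrite skew_evalZ mulVr ?hF.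
have Ha : skew_eval H a != 0.
  apply: contraNneq Ga0 => Ha0.
  by rewrite -[skew_eval G a](mulVKr (hF Gb0)) -skew_evalZ Ha0 mulr0.
apply: nconj; exists (skew_eval H a) => //.
suff -> : sigma (skew_eval H a) *m a + delta (skew_eval H a) =
    b *m (skew_eval H a)%:M.
  by rewrite -mulmxA -scalar_mxM divrr ?hF // mulmx1.
apply/colP => i; rewrite [RHS]mxE big_ord1 [X in _ * X]mxE eqxx mulr1n.
(* Entry i of the equality says that (x_i - b_i) H vanishes at [a]; by [cl] it suffices that it
   vanishes at [b] and on [Omega]. *)
apply/subr0_eq; rewrite -skew_eval_mulXB.
apply: cl => c [->|/G0 Gc0]; rewrite skew_eval_mulXB.
  by rewrite Hb rmorph1 mul1mx sderiv1 addr0 mulr1 subrr.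
by rewrite skew_evalZ Gc0 mulr0 rmorph0 mul0mx sderiv0 addr0 mulr0 subr0 mxE.
Qed.

(** The points of [B] are removed one at a time, along a list that enumerates them. *)
Lemma pclosureU_finite (A B : set 'cV[F]_n) a : finite_set B ->
  (forall b, B b -> ~ conjugate delta a b) ->
  pclosure delta (A `|` B) a -> pclosure delta A a.
Proof.
move=> /finite_seqP[s ->]; elim: s => [|b s IH] nconj.
  by rewrite classical_sets.set_nil setU0.
have -> : [set` b :: s] = b |` [set` s].
  apply/predeqP => c; split; rewrite /= inE.
    by case/predU1P => [->|cs]; [left|right].
  by case=> [->|/= ->]; rewrite ?eqxx ?orbT.
rewrite setUCA => /pclosureU1 cl.
apply: IH => [c cs|]; first by apply: nconj; rewrite /= inE cs orbT.
by apply: cl => //; apply: nconj; rewrite /= inE eqxx.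
Qed.

End SkewEvaluationTheory.

Theorem lemma20 (F : unitRingType) (hF : division_ring F)
    (n : nat) (hn : (0 < n)%N)
    (sigma : {rmorphism F -> 'M[F]_n}) (delta : sderivation sigma)
    (B1 B2 : set 'cV[F]_n)
    (fin1 : finite_set B1) (fin2 : finite_set B2)
    (ne1 : B1 !=set0) (ne2 : B2 !=set0)
    (ind1 : pindependent delta B1) (ind2 : pindependent delta B2)
    (hconj : forall a b, B1 a -> B2 b -> ~ conjugate delta a b) :
  pindependent delta (B1 `|` B2).
Proof.
move=> a [B1a|B2a] cl.
- apply: (ind1 a B1a); apply: (pclosureU_finite hF fin2) => [b|].
    exact: hconj.
  (* Deleting [a] from [B2] as well only shrinks the set, so monotonicity restores all of [B2]. *)
  by apply: pclosureS cl; rewrite setDUl; apply: setUS; exact: subDsetl.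
(* Here [a] lies in [B2], while [hconj] goes from [B1] to [B2]; symmetry of conjugacy reverses
   it. *)
- apply: (ind2 a B2a); apply: (pclosureU_finite hF fin1) => [b B1b /conjugate_sym|].
    by move=> /(_ hF); exact: hconj.
  by apply: pclosureS cl; rewrite setDUl setUC; apply: setUS; exact: subDsetl.
Qed.
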